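(* Let $(f_a)_{a\in\mathcal V}$ be a Multi-GM over a finite multi-graph $\mathcal G=(\mathcal V,\mathcal E)$. The Variational BP estimate $Z^{(\mathrm{vbp})}$ of the partition function can be stated as the max-min optimization $$Z^{(\mathrm{vbp})}=\sup_{\beta\in[0,1]^{\mathcal E}}\ \inf_{x\in\mathbb R_{+}^{\mathcal E_d}}\mathcal L(\beta,x),\qquad \mathcal L(\beta,x)=\Bigl(\prod_{\alpha\in\mathcal E}\beta_\alpha^{\beta_\alpha}(1-\beta_\alpha)^{1-\beta_\alpha}\Bigr)\prod_{a\in\mathcal V}\frac{h_a(x_a)}{\prod_{\gamma\in e_d(a)}x_\gamma^{\beta_{u(\gamma)}}},$$ where $\mathbb R_+^{\mathcal E_d}$ denotes vectors with strictly positive components and $0^0=1$.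
   Context: $\mathcal G=(\mathcal V,\mathcal E)$ is a finite undirected multi-graph; multiple edges and self-edges are allowed. Each $\alpha\in\mathcal E$ has two directed versions, $\alpha_d$ and its reverse $\bar\alpha_d$; $\mathcal E_d$ is the set of all directed edges, and $u(\alpha_d)=u(\bar\alpha_d)=\alpha$. Each directed edge is attached to exactly one node: for an edge joining two distinct nodes one of its two directed versions is attached to each end node; for a self-edge both directed versions are attached to its node. $e_d(a)$ is the set of directed edges attached to node $a$, and $\Sigma_a=\{0,1\}^{e_d(a)}$. A Multi-GM is a collection of factors $f_a:\Sigma_a\to[0,\infty)$, $a\in\mathcal V$. For $x=(x_\gamma)_{\gamma\in\mathcal E_d}$, $x_a=(x_\gamma)_{\gamma\in e_d(a)}$, put $h_a(x_a)=\sum_{s\in\Sigma_a}f_a(s)\prod_{\gamma\in e_d(a)}x_\gamma^{s_\gamma}$. Variational BP estimate: let $\Pi$ be the polytope of $(b,\beta)$ with $b_a(s)\in[0,1]$ ($a\in\mathcal V$, $s\in\Sigma_a$), $\beta\in[0,1]^{\mathcal E}$, such that $\sum_{s\in\Sigma_a}b_a(s)=1$ for all $a$ and $\sum_{s\in\Sigma_a,\,s_\gamma=1}b_a(s)=\beta_{u(\gamma)}$ for all $a$ and $\gamma\in e_d(a)$. Then $-\log Z^{(\mathrm{vbp})}=\min_{(b,\beta)\in\Pi}F^{(bp)}(b,\beta)$ with $$F^{(bp)}(b,\beta)=\sum_{a\in\mathcal V}\sum_{s\in\Sigma_a}b_a(s)\log\frac{b_a(s)}{f_a(s)}-\sum_{\alpha\in\mathcal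 E}\bigl(\beta_\alpha\log\beta_\alpha+(1-\beta_\alpha)\log(1-\beta_\alpha)\bigr).$$ Conventions: $0\log 0=0$, a term with $b_a(s)=0$ equals $0$, a term with $b_a(s)>0$, $f_a(s)=0$ equals $+\infty$, and $e^{-\infty}=0$. *)

(* Defs.v *)
From HB Require Import structures.
From mathcomp Require Import all_boot all_order all_algebra.
From mathcomp Require Import all_classical all_reals all_analysis.
Set Implicit Arguments.
Unset Strict Implicit.
Unset Printing Implicit Defensive.
Import Order.TTheory GRing.Theory Num.Theory.
Local Open Scope classical_set_scope.
Local Open Scope ring_scope.

(* A finite undirected multi-graph.  The directed versions of an edge [e] are
   [(e, false)] and [(e, true)], reverses of each other, and [attach] sends a
   directed edge to the node it is attached to.  The two (unordered) ends of
   [e] are thus [attach (e, false)] and [attach (e, true)]; [e] is a self-edge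
   when they coincide, and both versions are then attached to its node.  No
   condition on [attach] is needed: multiple edges and self-edges are allowed. *)
Record multigraph := Multigraph {
  node : finType;
  edge : finType;
  attach : edge * bool -> node }.

Definition dedge (G : multigraph) : finType := (edge G * bool)%type.

Definition undir (G : multigraph) (g : dedge G) : edge G := g.1.

Definition dedge_at (G : multigraph) (a : node G) : finType :=
  {g : dedge G | attach g == a}.

Definition config (G : multigraph) (a : node G) : finType :=
  {ffun dedge_at a -> bool}.

Definition factors (R : realType) (G : multigraph) : Type :=
  forall a : node G, config a -> R.

Definition is_multiGM (R : realType) (G : multigraph) (f : factors R G) : Prop :=
  forall (a : node G) (s : config a), 0 <= f a s.

Definition local_part (R : realType) (G : multigraph) (x : dedge G -> R)
  (a : node G) : dedge_at a -> R := fun g => x (val g).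

Definition hpoly (R : realType) (G : multigraph) (f : factors R G)
  (a : node G) (xa : dedge_at a -> R) : R :=
  \sum_(s : config a) f a s * \prod_(g : dedge_at a) xa g ^+ s g.

Definition unit_cube (R : realType) (G : multigraph) : set (edge G -> R) :=
  [set beta | forall e, 0 <= beta e <= 1].

Definition vbp_polytope (R : realType) (G : multigraph) :
  set (factors R G * (edge G -> R)) :=
  [set p | [/\ forall a (s : config a), 0 <= p.1 a s <= 1,
               unit_cube p.2,
               forall a, \sum_(s : config a) p.1 a s = 1 &
               forall a (g : dedge_at a),
                 \sum_(s : config a | s g) p.1 a s = p.2 (undir (val g))]].

Definition rel_entropy_term (R : realType) (b f : R) : \bar R :=
  if b == 0 then 0%E else if f == 0 then +oo%E else (b * ln (b / f))%:E.

(* [0 log 0 = 0] holds in the second sum because [ln 0 = 0]. *)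
Definition Fbp (R : realType) (G : multigraph) (f : factors R G)
  (p : factors R G * (edge G -> R)) : \bar R :=
  (\sum_(a : node G) \sum_(s : config a) rel_entropy_term (p.1 a s) (f a s)
   - (\sum_(e : edge G)
        (p.2 e * ln (p.2 e) + (1 - p.2 e) * ln (1 - p.2 e))%R)%:E)%E.

(* [Z] is the variational BP estimate: [- log Z] is the minimum, attained, of
   [Fbp f] over the polytope; [Z = 0] when this minimum is [+oo]. *)
Definition is_Zvbp (R : realType) (G : multigraph) (f : factors R G)
  (Z : \bar R) : Prop :=
  exists m : \bar R,
    [/\ (Fbp f @` @vbp_polytope R G) m,
        lbound (Fbp f @` @vbp_polytope R G) m &
        Z = expeR (- m)%E].

Definition positive_vectors (R : realType) (G : multigraph) :
  set (dedge G -> R) := [set x | forall g, 0 < x g].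

(* [powR] satisfies [0 `^ 0 = 1]. *)
Definition Lvbp (R : realType) (G : multigraph) (f : factors R G)
  (beta : edge G -> R) (x : dedge G -> R) : R :=
  (\prod_(e : edge G) (beta e `^ beta e * (1 - beta e) `^ (1 - beta e))) *
  \prod_(a : node G)
    (hpoly f (local_part x (a := a)) /
     \prod_(g : dedge_at a) x (val g) `^ beta (undir (val g))).

(* Main.v *)
Require Import Defs.
From HB Require Import structures.
From mathcomp Require Import all_boot all_order all_algebra.
From mathcomp Require Import all_classical all_reals all_analysis.
From mathcomp Require Import ring lra.
Set Implicit Arguments.
Unset Strict Implicit.
Unset Printing Implicit Defensive.
Import Order.TTheory GRing.Theory Num.Theory.
Import numFieldNormedType.Exports.
Local Open Scope classical_set_scope.
Local Open Scope ring_scope.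

(** Substituting [x = exp y], [log (L beta x)] is, up to the edge entropies, the
    convex function [sum_a log h_a(e^y) - <beta, y>] of [y].  Gibbs' inequality
    at each node bounds [- F(b, beta)] by it, whence
    [exp (- F(b, beta)) <= inf_x L(beta, x)].

    Conversely, let this function be bounded below for some [beta], possibly on
    the boundary of the cube or of the Newton polytopes, where no minimizing [y]
    need exist.  Adding [delta |y|^2] makes it coercive; the Gibbs beliefs
    [b_a(s) = f_a(s) e^{<s, y>} / h_a(e^y)] at the minimizer have marginals
    [beta - 2 delta y], which tend to [beta] with [delta], and their free energy
    is at most the negated infimum since the penalty contributes with the
    favourable sign.  Taking [beta] nearly optimal, compactness of the space of
    beliefs gives a point of the polytope that attains [- log] of the max-min. *)

(** * Continuity, minimization over boxes, and Gibbs' inequality *)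

Section analysis.
Context {R : realType}.

Lemma continuous_addr (T : topologicalType) (F H : T -> R) :
  continuous F -> continuous H -> continuous (fun x => F x + H x).
Proof. by move=> cF cH x; apply: cvgD; [exact: cF|exact: cH]. Qed.

Lemma continuous_subr (T : topologicalType) (F H : T -> R) :
  continuous F -> continuous H -> continuous (fun x => F x - H x).
Proof. by move=> cF cH x; apply: cvgB; [exact: cF|exact: cH]. Qed.

Lemma continuous_mulr (T : topologicalType) (F H : T -> R) :
  continuous F -> continuous H -> continuous (fun x => F x * H x).
Proof. by move=> cF cH x; apply: cvgM; [exact: cF|exact: cH]. Qed.

Lemma continuous_comp_expR (T : topologicalType) (F : T -> R) :
  continuous F -> continuous (fun x => expR (F x)).
Proof.
move=> cF x; apply: (@continuous_comp _ _ _ F (@expR R)); first exact: cF.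
exact: continuous_expR.
Qed.

Lemma continuous_comp_normr (T : topologicalType) (F : T -> R) :
  continuous F -> continuous (fun x => `|F x|).
Proof. by move=> cF x; apply: cvg_norm; exact: cF. Qed.

Lemma continuous_sumr (T : topologicalType) (J : Type) (r : seq J) (P : pred J)
    (F : J -> T -> R) :
  (forall j, continuous (F j)) ->
  continuous (fun x => \sum_(j <- r | P j) F j x).
Proof.
move=> cF; apply: (@continuous_big R J +%R 0 P _ T r F) => [|j _]; last exact: cF.
exact: add_continuous.
Qed.

Lemma continuous_coord (I : finType) (i : I) :
  continuous (fun x : {ptws I -> R} => x i).
Proof. exact: (@proj_continuous I (fun=> R) i). Qed.

(** In the topology of pointwise convergence the box is a product of segments, compact by
    Tychonoff's theorem. *)
Lemma box_argmin (I : finType) (F : {ptws I -> R} -> R) (lo hi : R) :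
  lo <= hi -> continuous F ->
  exists2 x : I -> R, forall i, lo <= x i <= hi &
    forall y : I -> R, (forall i, lo <= y i <= hi) -> F x <= F y.
Proof.
move=> lohi cF.
pose A : set {ptws I -> R} := [set x | forall i, `[lo, hi]%classic (x i)].
have cA : compact A.
  apply: (@tychonoff I (fun=> R) (fun=> `[lo, hi]%classic)) => i.
  exact: segment_compact.
have A0 : A !=set0 by exists (fun=> lo) => i /=; rewrite in_itv/= lexx.
have [x xA xmin] := compact_EVT_min A0 cA (continuous_subspaceT cF).
exists x => [i|y ybox].
  by move: xA; rewrite inE => /(_ i) /=; rewrite in_itv.
by apply: xmin; rewrite inE => i /=; rewrite in_itv/=; exact: ybox.
Qed.

(** As [ln] is 0 on nonpositive reals, only the right limit at 0 needs an estimate: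
    [|y ln y| <= 2 sqrt y] for small [y > 0]. *)
Lemma continuous_mul_ln : continuous (fun x : R => x * ln x).
Proof.
move=> x; rewrite /continuous_at; have [x0|x0|->] := ltgtP x 0.
- rewrite (ln0 (ltW x0)) mulr0; apply/cvgrPdist_le => e e0; near=> y.
  rewrite (@ln0 _ y) ?mulr0 ?subrr ?normr0 ?ltW//.
  by near: y; exact: lt_nbhsl.
- by apply: continuousM; [exact: cvg_id|exact: continuous_ln].
- rewrite mul0r; apply/cvgrPdist_le => e e0; near=> y.
  rewrite sub0r normrN.
  have [y0|y0] := leP y 0; first by rewrite ln0// mulr0 normr0 ltW.
  pose s := Num.sqrt y.
  have s0 : 0 < s by rewrite sqrtr_gt0.
  have ys : y = s ^+ 2 by rewrite sqr_sqrtr// ltW.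
  have s1 : s <= 1.
    by rewrite -[leRHS]sqrtr1 ler_sqrt// ltW//; near: y; exact: lt_nbhsl.
  have se : s <= e / 2.
    have e2 : 0 < e / 2 by rewrite divr_gt0.
    rewrite -(ger0_norm (ltW e2)) -sqrtr_sqr ler_sqrt ?sqr_ge0//.
    by rewrite ltW//; near: y; apply: lt_nbhsl; rewrite exprn_gt0// divr_gt0.
  (* [- ln y = 2 ln (1 / s) <= 2 / s] with [s = sqrt y] *)
  have lns : - ln s <= s^-1.
    by rewrite -lnV ?posrE// ltW// ln_sublinear// invr_gt0.
  have lns0 : ln s <= 0 by exact: ln_le0.
  rewrite ys lnXn// mulrnAr normrMn normrM (ler0_norm lns0).
  rewrite ger0_norm ?sqr_ge0//.
  have : s ^+ 2 * - ln s <= s ^+ 2 * s^-1 by rewrite ler_wpM2l ?sqr_ge0.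
  rewrite [s ^+ 2 * s^-1](_ : _ = s); last by rewrite expr2 mulfK ?gt_eqF.
  by rewrite mulr2n; lra.
Unshelve. all: by end_near. Qed.

Lemma ge0_right_limit (F : R -> R) :
  continuous F -> (forall t, 0 < t -> 0 <= F t) -> 0 <= F 0.
Proof.
move=> cF F0.
apply: (@cvgr_to_ge R (0^'+) _ R F) => //; first exact/cvg_at_right_filter/cF.
by near=> t; apply: F0; near: t; exact: nbhs_right_gt.
Unshelve. all: by end_near. Qed.

(** Gibbs' inequality for unnormalized weights: sum [ln q <= q - 1] at [q = w j / (b j * W)] against
    [b]. The linear terms cancel, since [b] and [w / W] both have mass 1. *)
Lemma ln_sum_le_rel_entropy (J : finType) (b w : J -> R) :
  (forall j, 0 <= b j) -> \sum_j b j = 1 ->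
  (forall j, 0 <= w j) -> (forall j, w j = 0 -> b j = 0) ->
  - ln (\sum_j w j) <= \sum_j b j * ln (b j / w j).
Proof.
move=> b0 b1 w0 wb; set W := \sum_j w j.
have W0 : 0 < W.
  rewrite lt_neqAle sumr_ge0 ?andbT; last by move=> *; exact: w0.
  apply/eqP => W0; suff : (0 : R) = 1 by move/eqP; rewrite eq_sym oner_eq0.
  rewrite -b1 big1// => j _; apply: wb.
  move/esym/eqP: W0; rewrite psumr_eq0// => /allP/(_ j (mem_index_enum _)).
  by move/eqP.
suff: \sum_j (b j - w j / W - b j * ln W) <= \sum_j b j * ln (b j / w j).
  rewrite !big_split/= b1 !sumrN -mulr_suml -mulr_suml b1 divff ?gt_eqF//.
  by rewrite subrr mul1r add0r.
apply: ler_sum => j _.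
have [bj0|bj0] := eqVneq (b j) 0.
  by rewrite bj0 !mul0r subr0 sub0r oppr_le0 divr_ge0// ltW.
have {}bj0 : 0 < b j by rewrite lt_neqAle eq_sym bj0 b0.
have wj0 : 0 < w j.
  by rewrite lt_neqAle w0 andbT eq_sym; apply/eqP => /wb/eqP; rewrite gt_eqF.
have -> : b j / w j = (w j / (b j * W))^-1 * W^-1.
  by field; rewrite !gt_eqF.
have q0 : 0 < w j / (b j * W) by rewrite divr_gt0// mulr_gt0.
rewrite lnM ?posrE ?invr_gt0// !lnV ?posrE// mulrDr !mulrN lerD2r.
have : ln (w j / (b j * W)) <= w j / (b j * W) - 1.
  have /le_ln1Dx : -1 < w j / (b j * W) - 1 by lra.
  by rewrite addrC subrK.
move=> /(ler_wpM2l (ltW bj0)); rewrite mulrBr mulr1.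
rewrite (_ : b j * (w j / _) = w j / W); last by field; rewrite !gt_eqF.
by lra.
Qed.

Lemma mul_ln_div (b w : R) : 0 <= b -> 0 <= w -> (w = 0 -> b = 0) ->
  b * ln (b / w) = b * ln b - b * ln w.
Proof.
move=> b0 w0 wb; have [->|bn0] := eqVneq b 0; first by rewrite !mul0r subrr.
have wn0 : w != 0 by apply: contraNneq bn0 => /wb ->.
by rewrite -mulrBr ln_div// posrE lt_neqAle eq_sym ?bn0 ?wn0.
Qed.

End analysis.

(** * Exponential tilting of the factors and Gibbs beliefs *)

Section multigraph.
Context {R : realType} {G : multigraph}.
Implicit Types (f b : factors R G) (beta : edge G -> R) (y : dedge G -> R).

(** The logarithm of the monomial of [hpoly] indexed by [s], at [x = exp y]. *)
Definition tilt y (a : node G) (s : config a) : R :=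
  \sum_(g : dedge_at a | s g) y (val g).

Definition tilted f y : factors R G :=
  fun a s => f a s * expR (tilt y s).

Definition node_sum f y (a : node G) : R := \sum_(s : config a) tilted f y s.

Definition edge_term beta : R :=
  \sum_(e : edge G) (beta e * ln (beta e) + (1 - beta e) * ln (1 - beta e)).

Definition potential f beta y : R :=
  \sum_(a : node G) ln (node_sum f y a) - \sum_(g : dedge G) beta (undir g) * y g.

(** Absolute continuity of [b] with respect to [f], the condition for [Fbp] to be finite. *)
Definition dominated f b : Prop :=
  forall (a : node G) (s : config a), f a s = 0 -> b a s = 0.

Definition rel_entropy b f : R :=
  \sum_(a : node G) \sum_(s : config a) b a s * ln (b a s / f a s).

(** Indexed by the directed edge alone, so that marginals can be summed over [dedge G];
    [marginal_val] gives back the form used in the polytope. *)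
Definition marginal b (g : dedge G) : R :=
  \sum_(s : config (attach g) | s (exist _ g (eqxx (attach g)))) b (attach g) s.

Lemma marginal_val b (a : node G) (g : dedge_at a) :
  marginal b (val g) = \sum_(s : config a | s g) b a s.
Proof.
case: g => g /= ga; move: (eqP ga) => e; subst a.
by rewrite /marginal (eq_irrelevance ga (eqxx _)).
Qed.

(** Each directed edge is attached to exactly one node, so the sets [dedge_at a] partition
    [dedge G]. *)
Lemma big_dedge (T : Type) (idx : T) (op : Monoid.com_law idx)
    (F : dedge G -> T) :
  \big[op/idx]_(g : dedge G) F g =
  \big[op/idx]_(a : node G) \big[op/idx]_(g : dedge_at a) F (val g).
Proof.
rewrite (partition_big (fun g : dedge G => attach g) predT)//=.
by apply: eq_bigr => a _; rewrite -big_sub.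
Qed.

Lemma sum_tilt b y :
  \sum_(a : node G) \sum_(s : config a) b a s * tilt y s =
  \sum_(g : dedge G) marginal b g * y g.
Proof.
rewrite big_dedge; apply: eq_bigr => a _.
transitivity (\sum_(s : config a) \sum_(g : dedge_at a)
    if s g then b a s * y (val g) else 0).
  by apply: eq_bigr => s _; rewrite /tilt mulr_sumr big_mkcond.
rewrite exchange_big/=; apply: eq_bigr => g _.
rewrite marginal_val mulr_suml [RHS]big_mkcond.
by apply: eq_bigr => s _; case: ifP.
Qed.

Lemma hpoly_expR f y (a : node G) :
  hpoly f (local_part (fun g => expR (y g)) (a := a)) = node_sum f y a.
Proof.
rewrite /hpoly /node_sum; apply: eq_bigr => s _.
rewrite /tilted /tilt expR_sum [in RHS]big_mkcond; congr *%R.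
by apply: eq_bigr => g _; case: (s g).
Qed.

Lemma powR_self (x : R) : x `^ x = expR (x * ln x).
Proof. by rewrite /powR; case: eqP => [->|//]; rewrite mul0r expR0. Qed.

Lemma Lvbp_expR f beta y : (forall a, 0 < node_sum f y a) ->
  Lvbp f beta (fun g => expR (y g)) = expR (potential f beta y + edge_term beta).
Proof.
move=> W0; rewrite /Lvbp addrC expRD; congr *%R.
  by rewrite expR_sum; apply: eq_bigr => e _; rewrite !powR_self expRD.
rewrite /potential big_dedge -sumrB expR_sum; apply: eq_bigr => a _.
rewrite hpoly_expR expRB lnK ?posrE//; congr (_ / _).
by rewrite expR_sum; apply: eq_bigr => g _; rewrite -expRM mulrC.
Qed.

Lemma tilted_eq0 f y (a : node G) (s : config a) :
  (tilted f y s == 0) = (f a s == 0).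
Proof. by rewrite /tilted mulf_eq0 expR_eq0 orbF. Qed.

(** On the support of [b], tilting [f] shifts the log-ratio by [tilt y s], whose mean depends on [b]
    only through its marginals ([sum_tilt]). *)
Lemma rel_entropy_tilted f b y : is_multiGM f -> is_multiGM b ->
  dominated f b ->
  rel_entropy b f =
  rel_entropy b (tilted f y) + \sum_(g : dedge G) marginal b g * y g.
Proof.
move=> f0 b0 fb; rewrite -sum_tilt -big_split/=; apply: eq_bigr => a _.
rewrite -big_split/=; apply: eq_bigr => s _.
have [bs0|bs0] := eqVneq (b a s) 0; first by rewrite bs0 !mul0r addr0.
have fs0 : 0 < f a s.
  by rewrite lt_neqAle f0 andbT eq_sym; apply: contraNneq bs0 => /fb ->.
have {}bs0 : 0 < b a s by rewrite lt_neqAle b0 andbT eq_sym.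
rewrite -mulrDr /tilted; congr (_ * _).
rewrite !ln_div ?posrE ?mulr_gt0 ?expR_gt0// lnM ?posrE ?expR_gt0//.
by rewrite expRK; ring.
Qed.

(** Gibbs' inequality at each node against the tilted weights; the linear term is that of
    [potential] because the marginals of [b] are [beta]. *)
Lemma rel_entropy_ge f b beta y : is_multiGM f -> @vbp_polytope R G (b, beta) ->
  dominated f b -> - potential f beta y <= rel_entropy b f.
Proof.
move=> f0 [/= b01 _ b1 bm] fb.
have b0 : is_multiGM b by move=> a s; have /andP[] := b01 a s.
rewrite (rel_entropy_tilted y f0 b0 fb) /potential opprB addrC.
rewrite [\sum_(g : dedge G) marginal b g * _](_ : _ =
    \sum_(g : dedge G) beta (undir g) * y g); last first.
  rewrite !big_dedge; apply: eq_bigr => a _; apply: eq_bigr => g _.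
  by rewrite marginal_val bm.
rewrite lerD2r -sumrN; apply: ler_sum => a _.
apply: ln_sum_le_rel_entropy => [s||s|s]; [exact: b0|exact: b1| |].
  by rewrite mulr_ge0 ?f0 ?expR_ge0.
by move=> /eqP; rewrite tilted_eq0 => /eqP/fb.
Qed.

Definition gibbs f y : factors R G := fun a s => tilted f y s / node_sum f y a.

Lemma gibbs_ge0 f y : is_multiGM f -> is_multiGM (gibbs f y).
Proof.
move=> f0 a s; rewrite divr_ge0 ?sumr_ge0// => *; by rewrite mulr_ge0 ?expR_ge0.
Qed.

Lemma sum_gibbs f y (a : node G) : 0 < node_sum f y a ->
  \sum_(s : config a) gibbs f y s = 1.
Proof. by move=> W0; rewrite -mulr_suml divff ?gt_eqF. Qed.

Lemma dominated_gibbs f y : dominated f (gibbs f y).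
Proof. by move=> a s fs0; rewrite /gibbs /tilted fs0 !mul0r. Qed.

(** Equality case of Gibbs' inequality: on the support, the ratio of Gibbs belief to tilted weight
    is constant at each node. *)
Lemma rel_entropy_gibbs f y : (forall a, 0 < node_sum f y a) ->
  rel_entropy (gibbs f y) (tilted f y) = - \sum_(a : node G) ln (node_sum f y a).
Proof.
move=> W0; rewrite -sumrN; apply: eq_bigr => a _.
transitivity (\sum_(s : config a) gibbs f y s * - ln (node_sum f y a)).
  apply: eq_bigr => s _; rewrite /gibbs.
  have [->|w0] := eqVneq (tilted f y s) 0; first by rewrite !mul0r.
  by rewrite -lnV ?posrE//; congr (_ * ln _); rewrite mulrAC divff// mul1r.
by rewrite -mulr_suml sum_gibbs// mul1r.
Qed.

End multigraph.

(** * Quadratic penalization and its stationarity condition *)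

Section strong_duality.
Context {R : realType} {G : multigraph}.
Context (f : factors R G) (beta : edge G -> R).
Context (f_ge0 : is_multiGM f).
Context (node_sum_gt0 : forall y a, 0 < node_sum f y a).

Definition penalized (delta : R) (y : dedge G -> R) : R :=
  potential f beta y + delta * \sum_(g : dedge G) y g ^+ 2.

Lemma continuous_penalized delta :
  continuous (fun y : {ptws dedge G -> R} => penalized delta y).
Proof.
rewrite /penalized /potential; apply: continuous_addr; last first.
  apply: continuous_mulr; first exact: cst_continuous.
  apply: continuous_sumr => g; rewrite /GRing.exp/=.
  by apply: continuous_mulr; exact: continuous_coord.
apply: continuous_subr; last first.
  apply: continuous_sumr => g.
  by apply: continuous_mulr; [exact: cst_continuous|exact: continuous_coord].
apply: continuous_sumr => a y.
apply: (@continuous_comp _ _ _ (fun w : {ptws dedge G -> R} => node_sum f w a)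
  (@ln R)); last first.
  exact: continuous_ln.
rewrite /node_sum /tilted /tilt; move: y; apply: continuous_sumr => s.
apply: continuous_mulr; first exact: cst_continuous.
apply: continuous_comp_expR; apply: continuous_sumr => g; exact: continuous_coord.
Qed.

Lemma tiltD (y d : dedge G -> R) t (a : node G) (s : config a) :
  tilt (fun g => y g + t * d g) s = tilt y s + t * tilt d s.
Proof. by rewrite /tilt mulr_sumr -big_split. Qed.

(** Stands in for differentiation: the factor of [t] on the right is continuous in [t], and its
    value at 0 is the directional derivative of [ln (node_sum f y a)] along [d]. It comes from
    [ln q <= q - 1] at the ratio of the two node sums. *)
Lemma ln_node_sumD (y d : dedge G -> R) t (a : node G) : 0 <= t ->
  ln (node_sum f (fun g => y g + t * d g) a) - ln (node_sum f y a) <=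
  t * \sum_(s : config a) gibbs f y s * (tilt d s * expR (t * tilt d s)).
Proof.
move=> t0; set W' := node_sum f _ a; set W := node_sum f y a.
have W0 : 0 < W by exact: node_sum_gt0.
have W'0 : 0 < W' by exact: node_sum_gt0.
rewrite -ln_div ?posrE//; apply: (@le_trans _ _ (W' / W - 1)).
  have q0 : 0 < W' / W by rewrite divr_gt0.
  have /le_ln1Dx : -1 < W' / W - 1 by lra.
  by rewrite addrC subrK.
rewrite -(sum_gibbs (node_sum_gt0 y a)) /W' /node_sum mulr_suml -sumrB mulr_sumr.
apply: ler_sum => s _.
have -> : tilted f (fun g => y g + t * d g) s / W =
    gibbs f y s * expR (t * tilt d s).
  by rewrite /gibbs /tilted tiltD expRD -/W; ring.
rewrite -[X in _ - X]mulr1 -mulrBr mulrCA ler_wpM2l ?gibbs_ge0//.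
rewrite mulrA; set x := t * tilt d s.
(* [e^x - 1 <= x e^x], from [1 - x <= e^-x] *)
have := expR_ge1Dx (- x) => /(ler_wpM2l (expR_ge0 x)).
by rewrite -expRD subrr expR0 mulrDr mulr1; lra.
Qed.

Lemma penalized_min_marginal delta y :
  (forall z, penalized delta y <= penalized delta z) ->
  forall g, marginal (gibbs f y) g = beta (undir g) - delta * y g *+ 2.
Proof.
move=> ymin.
have first_order d : 0 <= \sum_(g : dedge G)
    (marginal (gibbs f y) g - beta (undir g) + delta * y g *+ 2) * d g.
  (* For [t > 0], [F t] bounds from above the difference quotient of [penalized delta] at [y] along
     [d], which is nonnegative at a minimizer; [F 0] is the derivative itself. *)
  pose F t := \sum_(a : node G) \sum_(s : config a)
      gibbs f y s * (tilt d s * expR (t * tilt d s)) +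
    (t * (delta * \sum_(g : dedge G) d g ^+ 2) +
     \sum_(g : dedge G) (delta * y g *+ 2 - beta (undir g)) * d g).
  suff : 0 <= F 0.
    rewrite /F mul0r add0r.
    under eq_bigr do under eq_bigr do rewrite mul0r expR0 mulr1.
    rewrite sum_tilt -big_split/=.
    by congr (_ <= _); apply: eq_bigr => g _; ring.
  apply: ge0_right_limit => [t|t t0].
    move: t; apply: continuous_addr.
      apply: continuous_sumr => a; apply: continuous_sumr => s.
      apply: continuous_mulr; first exact: cst_continuous.
      apply: continuous_mulr; first exact: cst_continuous.
      apply: continuous_comp_expR.
      by apply: continuous_mulr; [move=> t; exact: cvg_id|exact: cst_continuous].
    apply: continuous_addr; last exact: cst_continuous.
    by apply: continuous_mulr; [move=> t; exact: cvg_id|exact: cst_continuous].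
  rewrite -(pmulr_rge0 _ t0).
  have := ymin (fun g => y g + t * d g).
  rewrite -subr_ge0 => /le_trans; apply.
  rewrite /penalized /potential /F.
  have : \sum_(a : node G) (ln (node_sum f (fun g => y g + t * d g) a) -
        ln (node_sum f y a)) <= t * \sum_(a : node G) \sum_(s : config a)
      gibbs f y s * (tilt d s * expR (t * tilt d s)).
    by rewrite mulr_sumr; apply: ler_sum => a _; exact/ln_node_sumD/ltW.
  rewrite sumrB.
  have -> : \sum_(g : dedge G) beta (undir g) * (y g + t * d g) =
      \sum_(g : dedge G) beta (undir g) * y g +
      t * \sum_(g : dedge G) beta (undir g) * d g.
    by rewrite mulr_sumr -big_split/=; apply: eq_bigr => g _; ring.
  have -> : \sum_(g : dedge G) (y g + t * d g) ^+ 2 =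
      \sum_(g : dedge G) y g ^+ 2 + t * (\sum_(g : dedge G) y g * d g *+ 2) +
      t * (t * \sum_(g : dedge G) d g ^+ 2).
    by rewrite !mulr_sumr -!big_split/=; apply: eq_bigr => g _; ring.
  have -> : \sum_(g : dedge G) (delta * y g *+ 2 - beta (undir g)) * d g =
      delta * (\sum_(g : dedge G) y g * d g *+ 2) -
      \sum_(g : dedge G) beta (undir g) * d g.
    by rewrite mulr_sumr -sumrB; apply: eq_bigr => g _; ring.
  by lra.
move=> g; apply/eqP; rewrite -subr_eq0 opprB addrCA addrC -sqrf_eq0.
pose D g := marginal (gibbs f y) g - beta (undir g) + delta * y g *+ 2.
have D2 : \sum_(g : dedge G) D g ^+ 2 = 0.
  apply/eqP; rewrite eq_le sumr_ge0 ?andbT => [|? _]; last exact: sqr_ge0.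
  (* [D] is the gradient; the direction [- D] forces its squared norm to be at most 0. *)
  have := first_order (fun g => - D g).
  by under eq_bigr do rewrite mulrN; rewrite sumrN oppr_ge0.
have /= := psumr_eq0P (fun g _ => sqr_ge0 (D g)) D2 (i := g) isT.
by rewrite /D => <-; apply/eqP; ring.
Qed.

(* As [potential] is bounded below, adding [delta * |y|^2] makes it coercive;
   the marginals of the Gibbs beliefs at the minimizer miss [beta] by
   [2 delta y], which is of order [sqrt delta]. *)
Lemma gibbs_approx c eta : 0 < eta -> (forall y, c <= potential f beta y) ->
  exists y, (forall g, `|marginal (gibbs f y) g - beta (undir g)| <= eta) /\
    rel_entropy (gibbs f y) f <= - c.
Proof.
move=> eta0 cpot.
pose K := potential f beta (fun=> 0) - c.
have K0 : 0 <= K by rewrite subr_ge0.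
have K1 : 0 < 4 * K + 1 by lra.
(* At the minimizer [delta * y g ^+ 2 <= K], so the marginal error satisfies
   [(2 delta y_g)^2 <= 4 delta K <= eta^2]. The added 1 keeps the denominator positive when
   [K = 0]. *)
pose delta := eta ^+ 2 / (4 * K + 1).
have delta0 : 0 < delta by rewrite divr_gt0 ?exprn_gt0.
have pen0 : penalized delta (fun=> 0) = c + K.
  rewrite /penalized big1 => [|g _]; last by rewrite expr0n.
  by rewrite mulr0 addr0 /K addrC subrK.
have pen_ge z g : c + delta * z g ^+ 2 <= penalized delta z.
  rewrite lerD// ler_wpM2l ?(ltW delta0)// (bigD1 g)//= lerDl.
  by rewrite sumr_ge0// => ? _; exact: sqr_ge0.
(* If some [|z g| > M >= 1], the penalty is at least [delta * M = delta + K], so [penalized] is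
   larger at [z] than at 0: the minimum over the box is global. *)
pose M := 1 + K / delta.
have M1 : 1 <= M by rewrite lerDl divr_ge0// ltW.
have [|y _ ymin] := box_argmin (lo := - M) (hi := M) _
    (@continuous_penalized delta); first lra.
have {}ymin z : penalized delta y <= penalized delta z.
  have [zM|] := pselect (forall g, - M <= z g <= M); first exact: ymin.
  move=> /existsNP[g /negP]; rewrite -ler_norml -ltNge => Mz.
  apply: (@le_trans _ _ (c + K)).
    by rewrite -pen0; apply: ymin => _; apply/andP; split; lra.
  apply: le_trans (pen_ge z g); rewrite lerD2l.
  have : delta * M = delta + K by rewrite /M mulrDr mulr1 mulrC divfK ?gt_eqF.
  have : M <= z g ^+ 2.
    rewrite -real_normK ?num_real//; apply: (le_trans (ltW Mz)).
    by rewrite ler_eXnr// (le_trans M1)// ltW.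
  by move=> /(ler_wpM2l (ltW delta0)); lra.
have marg := penalized_min_marginal ymin.
exists y; split => [g|].
  rewrite marg addrAC subrr add0r normrN.
  rewrite -(ger0_norm (ltW eta0)) -ler_sqr ?nnegrE// !real_normK ?num_real//.
  have := le_trans (pen_ge y g) (ymin (fun=> 0)).
  rewrite pen0 lerD2l => /(ler_wpM2l (ltW delta0)) yK.
  have : delta * (4 * K + 1) = eta ^+ 2 by rewrite divfK ?gt_eqF.
  by rewrite mulrDr mulr1 => <-; lra.
(* With these marginals the relative entropy equals [- potential f beta y - 2 delta |y|^2]. *)
rewrite (rel_entropy_tilted y) //; last 2 first.
- exact: gibbs_ge0.
- exact: dominated_gibbs.
rewrite rel_entropy_gibbs//.
have -> : \sum_(g : dedge G) marginal (gibbs f y) g * y g =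
    \sum_(g : dedge G) beta (undir g) * y g -
    delta * (\sum_(g : dedge G) y g ^+ 2) *+ 2.
  by rewrite mulr_sumr -sumrMnl -sumrB; apply: eq_bigr => g _; rewrite marg; ring.
have := cpot y; rewrite /potential.
have : 0 <= delta * \sum_(g : dedge G) y g ^+ 2.
  by rewrite mulr_ge0 ?(ltW delta0)// sumr_ge0// => ? _; exact: sqr_ge0.
by lra.
Qed.

End strong_duality.

(** * Attainment of the minimum by compactness *)

Section attainment.
Context {R : realType} {G : multigraph}.
Context (f : factors R G) (f_ge0 : is_multiGM f).

(** Node and edge beliefs form one real vector, so that [box_argmin] applies to the unit box. *)
Let I : finType := ({a : node G & config a} + edge G)%type.
Let belief (x : I -> R) : factors R G := fun a s => x (inl (existT _ a s)).
Let edge_belief (x : I -> R) : edge G -> R := fun e => x (inr e).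

(** Splitting the logarithm of the quotient reduces continuity on the whole space to that of
    [t * ln t]; [energyE] recovers the free energy. *)
Let energy (x : I -> R) : R :=
  \sum_(a : node G) \sum_(s : config a)
    (belief x s * ln (belief x s) - belief x s * ln (f s)) -
  edge_term (edge_belief x).

Let energyE x : is_multiGM (belief x) -> dominated f (belief x) ->
  energy x = rel_entropy (belief x) f - edge_term (edge_belief x).
Proof.
move=> b0 fb; congr (_ - _); apply: eq_bigr => a _; apply: eq_bigr => s _.
by rewrite mul_ln_div ?b0 ?f_ge0//; exact: fb.
Qed.

(* [|z| + z] is twice the positive part of [z]. *)
Let defect (v : R) (x : I -> R) : R :=
  \sum_(a : node G) `|\sum_(s : config a) belief x s - 1| +
  \sum_(a : node G) \sum_(s : config a) (f s == 0)%:R * `|belief x s| +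
  \sum_(g : dedge G) `|marginal (belief x) g - edge_belief x (undir g)| +
  (`|energy x - v| + (energy x - v)).

Let continuous_defect v : continuous (fun x : {ptws I -> R} => defect v x).
Proof.
have cb a s : continuous (fun x : {ptws I -> R} => belief x (a := a) s).
  exact: continuous_coord.
have ce e : continuous (fun x : {ptws I -> R} => edge_belief x e).
  exact: continuous_coord.
have cxlnx (F : {ptws I -> R} -> R) :
    continuous F -> continuous (fun x => F x * ln (F x)).
  move=> cF x; apply: (@continuous_comp _ _ _ F (fun t : R => t * ln t)).
    exact: cF.
  exact: continuous_mul_ln.
have cenergy : continuous (fun x : {ptws I -> R} => energy x).
  apply: continuous_subr.
    apply: continuous_sumr => a; apply: continuous_sumr => s.
    apply: continuous_subr; first exact/cxlnx.
    by apply: continuous_mulr => //; exact: cst_continuous.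
  apply: continuous_sumr => e; apply: continuous_addr; first exact: cxlnx.
  by apply/cxlnx/continuous_subr => //; exact: cst_continuous.
have cmarg g : continuous (fun x : {ptws I -> R} => marginal (belief x) g).
  by apply: continuous_sumr => s.
have cv : continuous (fun x : {ptws I -> R} => energy x - v).
  by apply: continuous_subr => //; exact: cst_continuous.
apply: continuous_addr; last by apply: continuous_addr => //; exact: continuous_comp_normr.
apply: continuous_addr; last first.
  by apply: continuous_sumr => g; apply/continuous_comp_normr/continuous_subr.
apply: continuous_addr; apply: continuous_sumr => a.
  apply/continuous_comp_normr/continuous_subr; last exact: cst_continuous.
  by apply: continuous_sumr => s.
apply: continuous_sumr => s; apply: continuous_mulr; first exact: cst_continuous.
exact/continuous_comp_normr.
Qed.

(** No subsequence is extracted: [defect v] is nonnegative and continuous, vanishes only if the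
    equality constraints and the energy bound hold, and is arbitrarily small on approximate
    solutions. Its minimizer over the unit box therefore has defect 0. *)
Lemma rel_entropy_attained (v : R) :
  (forall eta, 0 < eta -> exists b beta,
    [/\ is_multiGM b /\ dominated f b,
        forall a : node G, \sum_(s : config a) b a s = 1,
        unit_cube beta,
        forall g, `|marginal b g - beta (undir g)| <= eta &
        rel_entropy b f - edge_term beta <= v + eta]) ->
  exists2 p, @vbp_polytope R G p &
    dominated f p.1 /\ rel_entropy p.1 f - edge_term p.2 <= v.
Proof.
move=> approx.
have [x x01 xmin] := box_argmin ler01 (@continuous_defect v).
have sum_norm_ge0 (J : finType) (F : J -> R) : 0 <= \sum_j `|F j|.
  exact: sumr_ge0.
have pospart_ge0 (z : R) : 0 <= `|z| + z.
  by have := ler_norm (- z); rewrite normrN; lra.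
have off_ge0 y : 0 <= \sum_(a : node G) \sum_(s : config a)
    (f s == 0)%:R * `|belief y s|.
  by apply: sumr_ge0 => a _; apply: sumr_ge0 => s _; rewrite mulr_ge0.
have defect0 : defect v x <= 0.
  rewrite leNgt; apply/negP => dx0.
  (* An [eta]-approximate solution has defect at most [n * eta]: [eta] per directed edge and [2 eta]
     from the energy. This [eta] makes that half of the supposed positive minimum. *)
  pose n : R := #|dedge G|%:R + 2.
  have n0 : 0 < n by rewrite ltr_wpDl.
  pose eta := defect v x / (n * 2).
  have eta0 : 0 < eta by rewrite divr_gt0// mulr_gt0.
  have [b [beta [[b0 fb] b1 beta01 marg ent]]] := approx _ eta0.
  pose y (i : I) := match i with inl t => b (tag t) (tagged t) | inr e => beta e end.
  have y01 i : 0 <= y i <= 1.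
    case: i => [[a s]|e] /=; last exact: beta01.
    rewrite b0/= -(b1 a) (bigD1 s)//= lerDl.
    by apply: sumr_ge0 => ? _; exact: b0.
  have := xmin y y01; rewrite leNgt => /negP; apply.
  have -> : defect v x = n * eta *+ 2 by rewrite /eta; field; rewrite gt_eqF.
  have energy_y : energy y - v <= eta.
    by rewrite energyE// lerBlDl.
  rewrite /defect big1 => [|a _]; last first.
    by rewrite [X in X - _]b1 subrr normr0.
  rewrite big1 => [|a _]; last first.
    apply: big1 => s _; case: eqP => [/fb bs0|_]; last by rewrite mul0r.
    by rewrite mul1r [belief _ _]bs0 normr0.
  have : \sum_(g : dedge G) `|marginal (belief y) g - edge_belief y (undir g)| <=
      #|dedge G|%:R * eta.
    rewrite mulr_natl -sumr_const; apply: ler_sum => g _; exact: marg.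
  have : `|energy y - v| + (energy y - v) <= eta *+ 2.
    by have [?|?] := ger0P (energy y - v); lra.
  have : 0 < n * eta by rewrite mulr_gt0.
  by rewrite /n mulrDl; lra.
pose A := \sum_(a : node G) `|\sum_(s : config a) belief x s - 1|.
pose B := \sum_(a : node G) \sum_(s : config a) (f s == 0)%:R * `|belief x s|.
pose C := \sum_(g : dedge G) `|marginal (belief x) g - edge_belief x (undir g)|.
have A0 : 0 <= A by exact: sum_norm_ge0.
have B0 : 0 <= B by exact: off_ge0.
have C0 : 0 <= C by exact: sum_norm_ge0.
have E0 := pospart_ge0 (energy x - v).
move: defect0; rewrite /defect -/A -/B -/C => defect0.
have Ae : A = 0 by lra.
have Be : B = 0 by lra.
have Ce : C = 0 by lra.
have energy_x : energy x <= v.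
  have := ler_norm (energy x - v); lra.
have b0 : is_multiGM (belief x).
  by move=> a s; have /andP[] := x01 (inl (existT _ a s)).
have fb : dominated f (belief x).
  move=> a s fs0.
  have off_s a' (s' : config a') : 0 <= (f s' == 0)%:R * `|belief x s'|.
    exact: mulr_ge0.
  have off_a a' : 0 <= \sum_(s' : config a') (f s' == 0)%:R * `|belief x s'|.
    by apply: sumr_ge0 => s' _; exact: off_s.
  have Ba := psumr_eq0P (fun a' _ => off_a a') Be (i := a) isT.
  have := psumr_eq0P (fun s' _ => off_s a s') Ba (i := s) isT.
  by rewrite fs0 eqxx mul1r => /normr0_eq0.
exists (belief x, edge_belief x); last first.
  by split=> //=; rewrite -energyE.
split=> /= [a s|e|a|a g].
- exact: x01.
- exact: x01.
- apply/eqP; rewrite -subr_eq0; apply/eqP/normr0_eq0.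
  exact: (psumr_eq0P _ Ae).
- rewrite -marginal_val; apply/eqP; rewrite -subr_eq0; apply/eqP/normr0_eq0.
  exact: (psumr_eq0P _ Ce).
Qed.

End attainment.

(** * Extended-real free energy and weak duality *)

Section weak_duality.
Context {R : realType} {G : multigraph}.
Implicit Types (f b : factors R G) (beta : edge G -> R).

Lemma Fbp_dominated f (p : factors R G * (edge G -> R)) : dominated f p.1 ->
  Fbp f p = (rel_entropy p.1 f - edge_term p.2)%:E.
Proof.
move=> fb; rewrite /Fbp EFinB; congr (_ - _)%E.
rewrite /rel_entropy -sumEFin; apply: eq_bigr => a _.
rewrite -sumEFin; apply: eq_bigr => s _; rewrite /rel_entropy_term.
case: eqP => [->|bs0]; first by rewrite mul0r.
by case: eqP => [/fb|].
Qed.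

(** Some term is [+oo] and none is [-oo]. *)
Lemma Fbp_not_dominated f (p : factors R G * (edge G -> R)) :
  ~ dominated f p.1 -> Fbp f p = +oo%E.
Proof.
move=> /existsNP[a /existsNP[s /not_implyP[fs0 bs0]]].
have term_gtNy a' (s' : config a') :
    rel_entropy_term (p.1 a' s') (f a' s') != -oo%E.
  by rewrite /rel_entropy_term; case: ifP => // _; case: ifP.
rewrite /Fbp (_ : \sum_(a : node G) _ = +oo)%E//.
apply/esum_eqyP => [a' _|].
  by rewrite esum_eqNy; apply/existsP => -[s' /=]; apply/negP/term_gtNy.
exists a; rewrite mem_index_enum; split=> //.
apply/esum_eqyP => [s' _|]; first exact: term_gtNy.
exists s; rewrite mem_index_enum; split=> //; rewrite /rel_entropy_term.
by rewrite fs0 eqxx; case: eqP.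
Qed.

Lemma hpoly_ge0 f (x : dedge G -> R) (a : node G) : is_multiGM f ->
  positive_vectors x -> 0 <= hpoly f (local_part x (a := a)).
Proof.
move=> f0 x0; apply: sumr_ge0 => s _; rewrite mulr_ge0 ?f0//.
by apply: prodr_ge0 => g _; rewrite exprn_ge0// ltW// x0.
Qed.

Lemma Lvbp_ge0 f beta (x : dedge G -> R) : is_multiGM f ->
  positive_vectors x -> 0 <= Lvbp f beta x.
Proof.
move=> f0 x0; apply: mulr_ge0; apply: prodr_ge0 => i _.
  by rewrite mulr_ge0 ?powR_ge0.
rewrite divr_ge0 ?hpoly_ge0//.
by apply: prodr_ge0 => g _; exact: powR_ge0.
Qed.

Lemma node_sum_gt0 f y (a : node G) (s : config a) : is_multiGM f ->
  f a s != 0 -> 0 < node_sum f y a.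
Proof.
move=> f0 fs0; rewrite /node_sum (bigD1 s)//= ltr_pwDl//.
  by rewrite mulr_gt0 ?expR_gt0// lt_neqAle eq_sym fs0 f0.
by apply: sumr_ge0 => *; rewrite mulr_ge0 ?expR_ge0.
Qed.

(** A node whose factor is identically zero would make [Lvbp] vanish, and tilting preserves the
    support of a factor. *)
Lemma Lvbp_gt0_node_sum f beta x : is_multiGM f ->
  0 < Lvbp f beta x -> forall y a, 0 < node_sum f y a.
Proof.
move=> f0 L0 y a; have [[s fs0]|fa0] := pselect (exists s : config a, f a s != 0).
  exact: node_sum_gt0 fs0.
suff : Lvbp f beta x = 0 by move=> Le; rewrite Le ltxx in L0.
rewrite /Lvbp [X in _ * X](bigD1 a)//= [hpoly _ _]big1 ?mul0r ?mulr0// => s _.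
by have [->|fs0] := eqVneq (f a s) 0; [rewrite mul0r|case: fa0; exists s].
Qed.

Lemma Lvbp_potential f beta x y : is_multiGM f -> 0 < Lvbp f beta x ->
  Lvbp f beta (fun g => expR (y g)) = expR (potential f beta y + edge_term beta).
Proof. by move=> f0 L0; apply: Lvbp_expR => a; exact: Lvbp_gt0_node_sum L0 _ _. Qed.

Lemma expeR_Fbp_le f p x : is_multiGM f -> @vbp_polytope R G p ->
  positive_vectors x -> (expeR (- Fbp f p) <= (Lvbp f p.2 x)%:E)%E.
Proof.
case: p => b beta f0 pP x0.
have [fb|nfb] := pselect (dominated f b); last first.
  by rewrite Fbp_not_dominated//= lee_fin Lvbp_ge0.
rewrite Fbp_dominated//= lee_fin.
have W0 y a : 0 < node_sum f y a.
  have [_ _ b1 _] := pP.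
  have [s bs0] : exists s : config a, b a s != 0.
    apply/not_existsP => nb; have /eqP := b1 a.
    rewrite /= big1 ?(eq_sym 0) ?oner_eq0// => s _.
    by apply/eqP/negP => /negP; exact: nb.
  by apply: (node_sum_gt0 y f0 (s := s)); apply: contraNneq bs0 => /fb ->.
have -> : x = (fun g => expR (ln (x g))).
  by apply/funext => g; rewrite lnK// posrE; exact: x0.
rewrite Lvbp_expR// ler_expR opprB addrC lerD2r.
by have := rel_entropy_ge (fun g => ln (x g)) f0 pP fb; lra.
Qed.

Lemma Lvbp1_le f beta : is_multiGM f -> unit_cube beta ->
  Lvbp f beta (fun=> 1) <=
  \prod_(a : node G) hpoly f (local_part (fun=> 1) (a := a)).
Proof.
move=> f0 beta01; rewrite /Lvbp.
have -> : \prod_(a : node G) (hpoly f (local_part (fun=> 1) (a := a)) /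
      \prod_(g : dedge_at a) 1 `^ beta (undir (val g))) =
    \prod_(a : node G) hpoly f (local_part (fun=> 1) (a := a)).
  apply: eq_bigr => a _; rewrite big1 ?divr1// => g _.
  by rewrite powR1.
rewrite ler_piMl//; first by apply: prodr_ge0 => a _; rewrite hpoly_ge0.
have powR_self_le1 (t : R) : 0 <= t <= 1 -> t `^ t <= 1.
  move=> /andP[t0 t1].
  by rewrite powR_self -[leRHS]expR0 ler_expR mulr_ge0_le0// ln_le0.
apply: prodr_ile1 => e _; rewrite mulr_ge0 ?powR_ge0//=.
have /andP[e0 e1] := beta01 e.
by rewrite mulr_ile1 ?powR_ge0 ?powR_self_le1 ?e0// subr_ge0 e1 lerBlDr lerDl.
Qed.

(** The point mass at the zero configuration of each node, with [beta = 0]. *)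
Lemma vbp_polytope_neq0 : @vbp_polytope R G !=set0.
Proof.
exists (fun a s => (s == [ffun=> false])%:R, fun=> 0); split=> /=.
- by move=> a s; case: eqP; rewrite ?lexx ler01.
- by move=> e /=; rewrite lexx ler01.
- by move=> a; rewrite (bigD1 [ffun=> false])//= eqxx big1 ?addr0// => s /negbTE->.
- move=> a g; apply: big1 => s sg.
  by case: eqP => // s0; rewrite s0 ffunE in sg.
Qed.

End weak_duality.

Theorem mainTheorem7 (R : realType) (G : multigraph) (f : factors R G)
    (hf : is_multiGM f) :
  is_Zvbp f
    (ereal_sup [set ereal_inf [set (Lvbp f beta x)%:E
                              | x in @positive_vectors R G]
               | beta in @unit_cube R G]).
Proof.
set Z := ereal_sup _.
have ones : @positive_vectors R G (fun=> 1) by move=> g; exact: ltr01.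
have weak p : @vbp_polytope R G p -> (expeR (- Fbp f p) <= Z)%E.
  move=> pP; apply: le_ereal_sup_tmp.
  exists (ereal_inf [set (Lvbp f p.2 x)%:E | x in @positive_vectors R G]).
    by exists p.2 => //; case: pP.
  by apply: le_ereal_inf_tmp => _ [x x0 <-]; exact: expeR_Fbp_le.
have Z0 : (0 <= Z)%E.
  by have [p /weak] := @vbp_polytope_neq0 R G; apply/le_trans/expeR_ge0.
have Zfin : Z \is a fin_num.
  rewrite ge0_fin_numE//; apply: le_lt_trans (ltry
    (\prod_(a : node G) hpoly f (local_part (fun=> 1) (a := a)))).
  apply: ge_ereal_sup => _ [beta beta01 <-].
  apply: (@le_trans _ _ (Lvbp f beta (fun=> 1))%:E).
    by apply: ereal_inf_lbound; exists (fun=> 1).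
  by rewrite lee_fin Lvbp1_le.
move: Z0; rewrite le_eqVlt => /orP[/eqP Z0|Z0].
  (* When the max-min is 0, weak duality forces [Fbp f] to be [+oo] on the whole polytope, so every
     point attains the minimum. *)
  have Foo p : @vbp_polytope R G p -> Fbp f p = +oo%E.
    move=> /weak; rewrite -Z0 => Fle; apply: oppe_inj; apply/eqP.
    by rewrite -expeR_eq0 eq_le Fle expeR_ge0.
  exists +oo%E; split=> //.
    by have [p pP] := @vbp_polytope_neq0 R G; exists p => //; exact: Foo.
  by move=> _ [p /Foo -> <-].
pose r := fine Z.
have Zr : Z = r%:E by rewrite fineK.
have r0 : 0 < r by rewrite Zr lte_fin in Z0.
have lower p : @vbp_polytope R G p -> ((- ln r)%:E <= Fbp f p)%E.
  move=> /weak; rewrite Zr.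
  case: (Fbp f p) => [v||] /=; rewrite ?leey ?lee_fin//.
  by rewrite -{1}(lnK r0) ler_expR lerNl.
have [eta eta0|p pP [fp pv]] := rel_entropy_attained hf (v := - ln r).
  (* As [r > 0] is the supremum, some [beta] has an infimum above [r * expR (- eta)]. *)
  have [_ [beta beta01 <-] infL] : exists2 z, [set ereal_inf
        [set (Lvbp f beta x)%:E | x in @positive_vectors R G]
      | beta in @unit_cube R G] z & ((r * expR (- eta))%:E < z)%E.
    apply: ereal_sup_gt; rewrite -/Z Zr lte_fin gtr_pMr//.
    by rewrite -[ltRHS]expR0 ltr_expR oppr_lt0.
  have Lgt x : positive_vectors x -> r * expR (- eta) < Lvbp f beta x.
    move=> x0; rewrite -lte_fin; apply: lt_le_trans infL _.
    by apply: ereal_inf_lbound; exists x.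
  have L0 : 0 < Lvbp f beta (fun=> 1).
    by apply: lt_trans (Lgt _ ones); rewrite mulr_gt0 ?expR_gt0.
  have W0 := Lvbp_gt0_node_sum hf L0.
  (* This [c] is the logarithm of [r * expR (- eta)] minus the edge term, hence a lower bound of
     [potential f beta]. *)
  have [y|y [marg ent]] := gibbs_approx (beta := beta) hf W0
      (c := ln r - eta - edge_term beta) eta0.
    have : positive_vectors (fun g => expR (y g)) by move=> g; exact: expR_gt0.
    move=> /Lgt; rewrite (Lvbp_potential y hf L0).
    by rewrite -{1}(lnK r0) -expRD ltr_expR; lra.
  exists (gibbs f y), beta; split=> //.
  - by split; [exact: gibbs_ge0|exact: dominated_gibbs].
  - by move=> a; exact: sum_gibbs.
  - lra.
have Fp : Fbp f p = (- ln r)%:E.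
  apply/eqP; rewrite eq_le lower// andbT.
  by rewrite Fbp_dominated// lee_fin.
exists (- ln r)%:E; split.
- by exists p.
- by move=> _ [q /lower ? <-].
- by rewrite Zr /= opprK lnK.
Qed.
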